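(* Let $S$ be a $\mathrm{Cu}$-semigroup. Let $y$ and a sequence $(y_n)_{n=1}^{\infty}$ be in $\mathrm{Full}(S)$ with $y_n\leq y_{n+1}\leq y$ for all $n\in\mathbb{Z}_{>0}$. Assume that $\mathcal{F}_y(S)\neq\emptyset$ and $\lim_{n\to\infty}\rho(y,y_n)=1$. Then $\lim_{n\to\infty}\mathrm{rc}(S,y_n)=\mathrm{rc}(S,y)$.
   Context: For elements $x,y$ of a partially ordered set $P$, $x\ll y$ means: for every increasing sequence $(y_n)$ in $P$ with supremum $y$ there is $n_0$ with $x\leq y_{n_0}$. A $\mathrm{Cu}$-semigroup is a positively ordered abelian monoid $S$ (so $0\leq x$ for all $x$ and the order is compatible with addition) such that: (O1) every increasing sequence in $S$ has a supremum; (O2) every $x\in S$ is the supremum of a sequence $x_0\ll x_1\ll x_2\ll\cdots$; (O3) if $x'\ll x$ and $y'\ll y$ then $x'+y'\ll x+y$; (O4) $\sup_n(x_n+y_n)=\sup_n x_n+\sup_n y_n$ for all increasing sequences $(x_n),(y_n)$. For $x\in S$, $\infty\cdot x=\sup_n n\cdot x$. An element $x$ is full if $\infty\cdot x$ is the largest element of $S$; $\mathrm{Full}(S)$ is the set of full elements. A functional on $S$ is a map $\lambda\colon S\to[0,\infty]$ that is additive, order preserving, satisfies $\lambda(0)=0$, and preserves suprema of increasing sequences. $\mathcal{F}(S)$ is the set of functionals on $S$, and $\mathcal{F}_z(S)=\{\lambda\in\mathcal{F}(S):\lambda(z)=1\}$ for $z\in S$. The rank of $x$ is $\widehat{x}\colon\mathcal{F}(S)\to[0,\infty]$,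 $\widehat{x}(\lambda)=\lambda(x)$; inequalities between ranks are pointwise on $\mathcal{F}(S)$. Rank ratio: $\rho(x,y)=\inf\{r\in(0,\infty):\widehat{x}\leq r\cdot\widehat{y}\}$, with $\rho(x,y)=\infty$ if there is no such $r$. Radius of comparison: for $w\in\mathrm{Full}(S)$ and $r\in(0,\infty)$, $S$ has $r$-comparison relative to $w$ if whenever $x,y\in S$ satisfy $\widehat{x}+r\cdot\widehat{w}\leq\widehat{y}$, then $x\leq y$. $\mathrm{rc}(S,w)$ is the infimum of all $r\in(0,\infty)$ such that $S$ has $r$-comparison relative to $w$, and $\mathrm{rc}(S,w)=\infty$ if there is no such $r$. Limits are taken in $[0,\infty]$. *)

(* Defs.v *)
From HB Require Import structures.
From mathcomp Require Import all_boot all_order all_algebra.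
From mathcomp Require Import all_classical all_reals all_analysis.

Set Implicit Arguments.
Unset Strict Implicit.
Unset Printing Implicit Defensive.

Import Order.TTheory GRing.Theory Num.Theory.

Local Open Scope classical_set_scope.
Local Open Scope ring_scope.

Definition way_below {d} {P : porderType d} (x y : P) : Prop :=
  forall y_ : nat -> P, nondecreasing_seq y_ -> isLub (range y_) y ->
    exists n0, (x <= y_ n0)%O.

(* A commutative monoid together with a partial order; the compatibility axioms
   are part of is_Cu_semigroup. This is not an HB structure over nmodType and
   porderType because HB only accepts one that is declared before
   Num.POrderedZmodule, the existing join of additive magmas and preorders. *)
Record posetMonoid d := PosetMonoid {
  pm_poset : porderType d;
  pm_zero : pm_poset;
  pm_add : pm_poset -> pm_poset -> pm_poset;
  pm_addA : associative pm_add;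
  pm_addC : commutative pm_add;
  pm_add0 : left_id pm_zero pm_add
}.

Definition pm_carrier d (S : posetMonoid d) : Type := pm_poset S.
Coercion pm_carrier : posetMonoid >-> Sortclass.

HB.instance Definition _ d (S : posetMonoid d) :=
  Order.POrder.copy (pm_carrier S) (pm_poset S).
HB.instance Definition _ d (S : posetMonoid d) :=
  GRing.isNmodule.Build (pm_carrier S) (@pm_addA d S) (@pm_addC d S)
    (@pm_add0 d S).

Record is_Cu_semigroup d (S : posetMonoid d) : Prop := IsCuSemigroup {
  Cu_ge0 : forall x : S, ((0 : S) <= x)%O;
  Cu_leD : forall x y z : S, (x <= y)%O -> (x + z <= y + z :> S)%O;
  Cu_O1 : forall x_ : nat -> S, nondecreasing_seq x_ ->
    exists x, isLub (range x_) x;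
  Cu_O2 : forall x : S, exists x_ : nat -> S,
    (forall n, way_below (x_ n) (x_ n.+1)) /\ isLub (range x_) x;
  Cu_O3 : forall x' x y' y : S, way_below x' x -> way_below y' y ->
    way_below (x' + y' : S) (x + y : S);
  Cu_O4 : forall (x_ y_ : nat -> S) (x y : S),
    nondecreasing_seq x_ -> nondecreasing_seq y_ ->
    isLub (range x_) x -> isLub (range y_) y ->
    isLub (range (fun n => x_ n + y_ n : S)) (x + y : S)
}.

Section CuSemigroup.
Context {d : Order.disp_t} {S : posetMonoid d}.
Implicit Types x y z w : S.

(* In a Cu-semigroup the supremum exists by (O1), since the sequence is
   nondecreasing; the default value 0 is then irrelevant. *)
Definition cu_infty x : S := supremum (0 : S) (range (fun n : nat => x *+ n : S)).

Definition Full : set S := [set x | forall z, (z <= cu_infty x)%O].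

Variable R : realType.
Local Open Scope ereal_scope.

(* [0, oo] is rendered as the nonnegative part of \bar R. *)
Definition functionals : set (S -> \bar R) :=
  [set lambda | [/\ forall x, 0 <= lambda x,
    lambda 0%R = 0,
    forall x y, lambda (x + y)%R = lambda x + lambda y,
    forall x y, (x <= y)%O -> lambda x <= lambda y
  & forall (x_ : nat -> S) (x : S),
      nondecreasing_seq x_ -> isLub (range x_) x ->
      ereal_sup (range (lambda \o x_)) = lambda x]].

Definition normalized_functionals z : set (S -> \bar R) :=
  [set lambda | functionals lambda /\ lambda z = 1].

Definition rank x (lambda : S -> \bar R) : \bar R := lambda x.

(* ereal_inf set0 = +oo, which is the convention for both infima below. *)
Definition rank_ratio x y : \bar R :=
  ereal_inf [set r%:E | r in [set r : R | (0 < r)%R /\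
    forall lambda, functionals lambda ->
      rank x lambda <= r%:E * rank y lambda]].

Definition has_comparison w (r : R) : Prop :=
  forall x y,
    (forall lambda, functionals lambda ->
      rank x lambda + r%:E * rank w lambda <= rank y lambda) ->
    (x <= y)%O.

Definition radius_comparison w : \bar R :=
  ereal_inf [set r%:E | r in [set r : R | (0 < r)%R /\ has_comparison w r]].

End CuSemigroup.

Arguments functionals {d} S R.
Arguments Full {d} S.
Arguments normalized_functionals {d S} R z.
Arguments rank_ratio {d S} R x y.
Arguments radius_comparison {d S} R w.

(* Main.v *)
(** If the rank of w' is at most that of w, then rc(w) <= rc(w'); if the rank of
    w is at most t times that of w', then rc(w') <= t rc(w). Hence
    rc(y) <= rc(y_n) <= rho(y, y_n) rc(y), and one squeezes. *)
Require Import Defs.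
From mathcomp Require Import all_boot all_order all_algebra.
From mathcomp Require Import all_classical all_reals all_analysis.
Import Order.TTheory GRing.Theory Num.Theory.
Local Open Scope classical_set_scope.
Local Open Scope ring_scope.
Local Open Scope ereal_scope.

Section RadiusComparison.
Local Set Implicit Arguments.
Local Unset Strict Implicit.
Context {R : realType} {d : Order.disp_t} {S : posetMonoid d}.
Implicit Types (w : S) (r t : R).

(** Since [r * rank w <= t * r * rank w'], a pair that meets the premise of [t * r]-comparison
    relative to [w'] meets that of [r]-comparison relative to [w]. *)
Lemma has_comparisonM w w' t r : (0 < t)%R -> (0 < r)%R ->
  (forall lambda, functionals S R lambda ->
    rank w lambda <= t%:E * rank w' lambda) ->
  has_comparison w r -> has_comparison w' (t * r)%R.
Proof.
move=> t0 r0 le_w cmp x z le_xz; apply: cmp => lambda Flambda.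
apply: le_trans (le_xz _ Flambda); rewrite leeD2l// mulrC EFinM -muleA.
by apply: lee_wpmul2l; [rewrite lee_fin ltW|exact: le_w].
Qed.

Lemma radius_comparison_ge0 w : 0 <= radius_comparison R w.
Proof. by apply: le_ereal_inf_tmp => _ [r [/ltW r0 _] <-]; rewrite lee_fin. Qed.

Lemma radius_comparison_le_mul w w' t : (0 < t)%R ->
  (forall lambda, functionals S R lambda ->
    rank w lambda <= t%:E * rank w' lambda) ->
  radius_comparison R w' <= t%:E * radius_comparison R w.
Proof.
(* A positive real factor passes through the infimum, so it suffices to treat each admissible [r]
   separately. *)
move=> t0 le_w; rewrite -ereal_inf_pZl//.
apply: le_ereal_inf_tmp => _ [_ [r [r0 cmp] <-] <-].
apply: ereal_inf_lbound; exists (t * r)%R; rewrite ?EFinM//.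
by split; [rewrite mulr_gt0|exact: (has_comparisonM t0 r0 le_w)].
Qed.

Lemma radius_comparison_anti w w' :
  (w <= w')%O -> radius_comparison R w' <= radius_comparison R w.
Proof.
move=> le_ww'; rewrite -[leRHS]mul1e; apply: radius_comparison_le_mul => //.
by move=> lambda [_ _ _ mono _]; rewrite mul1e; exact: mono.
Qed.

(** Take the infimum over [t] in the previous scaling bound. Both finiteness hypotheses keep out the
    product of 0 and [+oo], which is 0 by convention. *)
Lemma radius_comparison_le_rank_ratio w w' :
  rank_ratio R w w' < +oo -> radius_comparison R w < +oo ->
  radius_comparison R w' <= rank_ratio R w w' * radius_comparison R w.
Proof.
move=> /ereal_inf_lt[_ [t [t0 le_t] _] _].
have := radius_comparison_ge0 w.
case rcE : (radius_comparison R w) => [c| |]// c0 _.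
(* The infimum over [t] can be scaled by [c] only for [c > 0]. For [c = 0] the single admissible [t]
   found above already gives the bound 0. *)
have [c0'|c0'] := leP c 0%R.
  have {c0 c0'} c0 : c = 0%R by apply/le_anti; rewrite c0' -lee_fin.
  have := radius_comparison_le_mul t0 le_t.
  by rewrite rcE c0 !mule0.
rewrite muleC -ereal_inf_pZl//.
apply: le_ereal_inf_tmp => _ [_ [r [r0 le_r] <-] <-].
by rewrite muleC -rcE; exact: radius_comparison_le_mul.
Qed.
End RadiusComparison.

Theorem corollary5p5 (R : realType) (d : Order.disp_t)
    (S : posetMonoid d) (S_Cu : is_Cu_semigroup S)
    (y : S) (y_ : nat -> S)
    (y_full : Full S y) (y_n_full : forall n : nat, (0 < n)%N -> Full S (y_ n))
    (y_n_le : forall n : nat, (0 < n)%N ->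
      (y_ n <= y_ n.+1)%O /\ (y_ n.+1 <= y)%O)
    (Fy_neq0 : normalized_functionals R y !=set0)
    (rho_cvg : rank_ratio R y (y_ n) @[n --> \oo] --> (1 : \bar R)) :
  radius_comparison R (y_ n) @[n --> \oo] --> radius_comparison R y.
Proof.
have rc_le n : (0 < n)%N -> radius_comparison R y <= radius_comparison R (y_ n).
  move=> /y_n_le[le1 le2]; apply: radius_comparison_anti.
  exact: le_trans le1 le2.
(* The infinite case stands apart because the upper bound of the squeeze needs a finite radius; here
   the lower bound alone forces [+oo] for all [n > 0]. *)
have [rc_oo|rc_fin] := eqVneq (radius_comparison R y) +oo.
  rewrite rc_oo; apply: cvg_near_cst; near=> n.
  apply/eqP; rewrite -leye_eq -rc_oo; apply: rc_le.
  by near: n; exact: nbhs_infty_gt.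
have rc_lty : radius_comparison R y < +oo by rewrite ltey.
have rc_num : radius_comparison R y \is a fin_num.
  by rewrite ge0_fin_numE// radius_comparison_ge0.
apply: (@squeeze_cvge _ _ _ _ (fun=> radius_comparison R y) _
  (fun n => rank_ratio R y (y_ n) * radius_comparison R y)).
(* The ratios tend to the finite value 1, hence are eventually finite. The index 0 must be avoided
   too, as [y_ 0] is arbitrary. *)
- have [rho_num _] := (fine_cvgP _ _).1 rho_cvg.
  near=> n; apply/andP; split.
    by apply: rc_le; near: n; exact: nbhs_infty_gt.
  apply: radius_comparison_le_rank_ratio => //.
  by rewrite ltey_eq; apply/orP; left; near: n.
- exact: cvg_cst.
(* Multiplication by the finite [radius_comparison R y] is continuous. *)
- by rewrite -[X in _ --> X]mul1e; exact: cvgeZr.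
Unshelve. all: by end_near. Qed.
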